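(* Let $f(x)=x^4+a_2x^2+a_1x+a_0$ with real coefficients such that $a_1\neq0$ and $a_2<0$. If $x_1$ and $x_2$ are the two distinct local minimizers of $f$ (when $f$ has two), then $\operatorname{sgn}(x_1)=-\operatorname{sgn}(x_2)$. Moreover, if $x^*$ is the global minimizer of $f$, then $|x^*|>\sqrt{-a_2/6}$ and, in particular, $\operatorname{sgn}(x^* )=-\operatorname{sgn}(a_1)$.
   Context: $\operatorname{sgn}$ denotes the sign function, with values in $\{-1,0,1\}$. *)

(* Defs.v *)
From HB Require Import structures.
From mathcomp Require Import all_boot all_order all_algebra.
From mathcomp Require Import all_classical all_reals all_analysis.

Set Implicit Arguments.
Unset Strict Implicit.
Unset Printing Implicit Defensive.

Import Order.TTheory GRing.Theory Num.Theory.
Import numFieldNormedType.Exports.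

Local Open Scope classical_set_scope.
Local Open Scope ring_scope.

Definition quartic (R : realType) (a2 a1 a0 : R) (x : R) : R :=
  x ^+ 4 + a2 * x ^+ 2 + a1 * x + a0.

Definition local_minimizer (R : realType) (f : R -> R) (x : R) : Prop :=
  \forall y \near x, f x <= f y.

Definition global_minimizer (R : realType) (f : R -> R) (x : R) : Prop :=
  forall y : R, f x <= f y.

(* Main.v *)
Require Import Defs.
From HB Require Import structures.
From mathcomp Require Import all_boot all_order all_algebra.
From mathcomp Require Import all_classical all_reals all_analysis.
From mathcomp Require Import ring lra.

Set Implicit Arguments.
Unset Strict Implicit.
Unset Printing Implicit Defensive.

Import Order.TTheory GRing.Theory Num.Theory.
Import numFieldNormedType.Exports.

Local Open Scope ring_scope.

(** The increment of the quartic at [x] is exactly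
      [f (x + h) - f x = h f'(x) + h ^ 2 (6 x ^ 2 + a2) + h ^ 3 (4 x + h)].
    At a local minimizer it is nonnegative for small [h], so its first nonzero
    coefficient has even order and is positive. Hence [f'(x) = 0] and
    [6 x ^ 2 + a2 >= 0]; equality is excluded because it would make the cubic
    coefficient [4 x] vanish too, whereas [a2 < 0]. So every local minimizer is
    a critical point with [- a2 < 6 x ^ 2] ([local_minimizer_quartic]).

    If [x1 <> x2] are two such points, subtracting the equations
    [f'(x1) = 0 = f'(x2)] and dividing by [x1 - x2] gives
    [2 (x1 ^ 2 + x1 x2 + x2 ^ 2) = - a2]. Were [x1] and [x2] of the same sign,
    then [x1 x2 > - a2 / 6], and the left-hand side would exceed [- a2].

    A global minimizer [xs] is local, which gives the bound on its absolute
    value; comparing [f xs] with [f (- xs)], where only the linear term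
    changes, gives [a1 xs <= 0], and neither factor vanishes. *)

(** The leading coefficient of an expansion that is nonnegative near [0] is the
    limit, as [h] decreases to [0], of the expansion divided by [h ^+ n]. *)
Lemma leading_coef_ge0 (R : realType) (g : R -> R) (n : nat) :
  {for 0, continuous g} -> (\forall h \near 0, 0 <= h ^+ n * g h) -> 0 <= g 0.
Proof.
move=> cg hg.
apply: (cvgr_to_ge (cvg_at_right_filter cg)).
near=> h.
have h0 : 0 < h by near: h; exact: nbhs_right_gt.
rewrite -(pmulr_rge0 _ (exprn_gt0 n h0)).
by near: h; apply: cvg_within.
Unshelve. all: by end_near. Qed.

(** For odd [n], substituting [- h] for [h] reverses the sign of the leading
    term, so the one-sided bound applies to both [g] and [h |-> - g (- h)]. *)
Lemma odd_leading_coef_eq0 (R : realType) (g : R -> R) (n : nat) : odd n ->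
  {for 0, continuous g} -> (\forall h \near 0, 0 <= h ^+ n * g h) -> g 0 = 0.
Proof.
move=> on cg hg; apply/eqP; rewrite eq_le (leading_coef_ge0 cg hg) andbT.
rewrite -oppr_ge0 -[X in g X]oppr0.
apply: (@leading_coef_ge0 _ (fun h => - g (- h)) n).
  apply: continuousN; apply: continuous_comp; first exact: oppr_continuous.
  by rewrite oppr0.
move: hg; rewrite -{1}oppr0 => /nearN; apply: filterS => h.
by rewrite exprNn -signr_odd on expr1 mulN1r mulNr mulrN.
Qed.

Lemma quartic_increment (R : realType) (a2 a1 a0 x h : R) :
  quartic a2 a1 a0 (x + h) - quartic a2 a1 a0 x =
  h * (4 * x ^+ 3 + 2 * a2 * x + a1 + h * (6 * x ^+ 2 + a2 + h * (4 * x + h))).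
Proof. by rewrite /quartic; ring. Qed.

(** The coefficients of the increment are examined one order at a time: orders
    [1] and [3] are odd, so a leading coefficient there must vanish, whereas
    order [2] only forces nonnegativity. If [6 x ^ 2 + a2] were zero, order [3]
    would lead and force [x = 0], hence [a2 = 0]. *)
Lemma local_minimizer_quartic (R : realType) (a2 a1 a0 x : R) : a2 < 0 ->
  local_minimizer (quartic a2 a1 a0) x ->
  4 * x ^+ 3 + 2 * a2 * x + a1 = 0 /\ - a2 < 6 * x ^+ 2.
Proof.
move=> a2_lt0 /nbhs0P.
set c1 := _ + a1 => min_x; set c2 := 6 * x ^+ 2 + a2.
have min0 : \forall h \near 0, 0 <= h * (c1 + h * (c2 + h * (4 * x + h))).
  by apply: filterS min_x => h; rewrite -subr_ge0 quartic_increment.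
have cont3 : {for 0, continuous (fun h : R => 4 * x + h)}.
  by apply: continuousD; [exact: cst_continuous|].
have cont2 : {for 0, continuous (fun h : R => c2 + h * (4 * x + h))}.
  by apply: continuousD; [exact: cst_continuous|apply: continuousM].
have cont1 : {for 0, continuous (fun h : R => c1 + h * (c2 + h * (4 * x + h)))}.
  by apply: continuousD; [exact: cst_continuous|apply: continuousM].
have c1_eq0 : c1 = 0.
  by have := odd_leading_coef_eq0 (n := 1) isT cont1 min0; rewrite mul0r addr0.
split=> //.
have c2_ge0 : 0 <= c2.
  have := leading_coef_ge0 (n := 2) cont2; rewrite mul0r addr0; apply.
  by apply: filterS min0 => h; rewrite c1_eq0 add0r mulrA.
have c2_neq0 : c2 != 0.
  apply/eqP => c2_eq0.
  have x4_eq0 : 4 * x = 0.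
    have := odd_leading_coef_eq0 (n := 3) isT cont3; rewrite addr0; apply.
    by apply: filterS min0 => h; rewrite c1_eq0 c2_eq0 !add0r !mulrA -expr2 -exprSr.
  have x_eq0 : x = 0 by lra.
  by move: c2_eq0; rewrite /c2 x_eq0; lra.
have : 0 < c2 by rewrite lt_neqAle eq_sym c2_neq0.
by rewrite /c2; lra.
Qed.

(** Multiplying the two lower bounds gives [(- a2) ^ 2 < (6 x1 x2) ^ 2], so a
    nonnegative product would exceed [- a2 / 6], contradicting the equation
    [2 (x1 ^ 2 + x1 x2 + x2 ^ 2) = - a2] obtained by cancelling [x1 - x2] in
    the difference of the critical point equations. *)
Lemma mul_minimizers_lt0 (R : realType) (a2 a1 x1 x2 : R) : a2 < 0 -> x1 <> x2 ->
  4 * x1 ^+ 3 + 2 * a2 * x1 + a1 = 0 -> - a2 < 6 * x1 ^+ 2 ->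
  4 * x2 ^+ 3 + 2 * a2 * x2 + a1 = 0 -> - a2 < 6 * x2 ^+ 2 ->
  x1 * x2 < 0.
Proof.
move=> a2_lt0 x12 crit1 large1 crit2 large2; rewrite ltNge; apply/negP => x12_ge0.
have secant : 2 * (x1 ^+ 2 + x1 * x2 + x2 ^+ 2) + a2 = 0.
  have /mulfI : x1 - x2 != 0 by rewrite subr_eq0; apply/eqP.
  by apply; rewrite mulr0; lra.
have : (- a2) ^+ 2 < (6 * (x1 * x2)) ^+ 2.
  have -> : (6 * (x1 * x2)) ^+ 2 = (6 * x1 ^+ 2) * (6 * x2 ^+ 2) by ring.
  by rewrite expr2; apply: ltr_pM => //; lra.
rewrite ltr_sqr ?nnegrE; [|lra|lra].
by lra.
Qed.

Lemma sgr_opp_mul_lt0 (R : realDomainType) (x y : R) :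
  x * y < 0 -> Num.sg x = - Num.sg y.
Proof.
move=> xy_lt0; have : Num.sg (x * y) = -1 by rewrite ltr0_sg.
rewrite sgrM.
by case: (sgrP x); case: (sgrP y) => _ _; rewrite ?(mul0r, mulr0); lra.
Qed.

Theorem lemma4 (R : realType) (a2 a1 a0 : R) (ha1 : a1 <> 0) (ha2 : a2 < 0) :
  (forall x1 x2 : R, x1 <> x2 ->
     local_minimizer (quartic a2 a1 a0) x1 ->
     local_minimizer (quartic a2 a1 a0) x2 ->
     Num.sg x1 = - Num.sg x2) /\
  (forall xs : R, global_minimizer (quartic a2 a1 a0) xs ->
     Num.sqrt (- a2 / 6) < `|xs| /\ Num.sg xs = - Num.sg a1).
Proof.
split=> [x1 x2 x12 /(local_minimizer_quartic ha2)[crit1 large1]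
  /(local_minimizer_quartic ha2)[crit2 large2]|xs min_xs].
  exact/sgr_opp_mul_lt0/(mul_minimizers_lt0 ha2 x12 crit1 large1 crit2 large2).
have /(local_minimizer_quartic ha2)[_ large] :
    local_minimizer (quartic a2 a1 a0) xs.
  by rewrite /local_minimizer; near=> y; exact: min_xs.
have xs_neq0 : xs != 0 by apply/eqP => xs0; move: large; rewrite xs0; lra.
split.
  by rewrite -sqrtr_sqr ltr_sqrt ?exprn_even_gt0 //; lra.
apply: sgr_opp_mul_lt0; rewrite lt_neqAle mulf_neq0 //=; last by apply/eqP.
by have := min_xs (- xs); rewrite /quartic; lra.
Unshelve. all: by end_near. Qed.
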